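(* Let $X$ be $\mathbb{R}^3$ with the norm $\|(x,y,z)\|=\sqrt{x^2+y^2}+|z|$. Let $A=\{\alpha_i : i=1,2,\dots,5\}\subseteq X$ be a $1$-equilateral set of five points, and let $\alpha'_i$ denote the $z$-coordinate of $\alpha_i$. Suppose that $\alpha_5=(0,0,0)$, $\alpha_4=(0,d,1-d)$ with $0<d<\frac14$, and that $\alpha'_5\le\alpha'_3\le\alpha'_2\le\alpha'_1\le\alpha'_4$. Then $A$ has no center, i.e. there are no point $\alpha_k\in X$ and no $r>0$ such that $\|\alpha_k-\alpha_i\|=r$ for all $i=1,2,\dots,5$.
   Context: A set is $1$-equilateral if any two distinct points of it are at distance exactly $1$ in the norm of $X$. *)

(* Defs.v *)
From HB Require Import structures.
From mathcomp Require Import all_boot all_order all_algebra.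
From mathcomp Require Import classical_sets reals.

Set Implicit Arguments.
Unset Strict Implicit.
Unset Printing Implicit Defensive.
Import Order.TTheory GRing.Theory Num.Theory.
Local Open Scope classical_set_scope.
Local Open Scope ring_scope.

Definition point3 (R : realType) (x y z : R) : 'rV[R]_3 :=
  \row_(j < 3) [:: x; y; z]`_j.

Definition xcoord (R : realType) (v : 'rV[R]_3) : R := v 0 0.
Definition ycoord (R : realType) (v : 'rV[R]_3) : R := v 0 1.
Definition zcoord (R : realType) (v : 'rV[R]_3) : R := v 0 2.

Definition normX (R : realType) (v : 'rV[R]_3) : R :=
  Num.sqrt (xcoord v ^+ 2 + ycoord v ^+ 2) + `|zcoord v|.

Definition equilateral1 (R : realType) (A : set 'rV[R]_3) : Prop :=
  forall a b, A a -> A b -> a <> b -> normX (a - b) = 1.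

(* A center is a point of the whole space; it need not lie in A. *)
Definition has_center (R : realType) (A : set 'rV[R]_3) : Prop :=
  exists (c : 'rV[R]_3) (r : R), 0 < r /\ forall a, A a -> normX (c - a) = r.

Lemma point3E (R : realType) (x y z : R) :
  (xcoord (point3 x y z) = x) * (ycoord (point3 x y z) = y) *
  (zcoord (point3 x y z) = z).
Proof. by rewrite /xcoord /ycoord /zcoord !mxE. Qed.

(* Main.v *)
(** Identify points with their horizontal projections, and write [q] for [alpha4]
    and [0] for [alpha5].  Distance 1 from both gives [|Q| + |Q - q| = 1 + |q|] for
    each of the other three points [Q].  If such a [Q] is not higher than a center
    [p], then also [|Q| + |Q - p| = 1 + |p|].  After possibly turning the
    configuration upside down, two of the three points, [Q1] and [Q2], are not
    higher than [p], and the third one, [P], is at least as high as they are, so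
    that [|Qi| + |Qi - P| = 1 + |P|] as well.  The equations
    [|Qi| + |Qi - u| = 1 + |u|] are linear in [u] and [|u|]; as [Q1] and [Q2] are
    linearly independent, [u] is an affine function of [|u|], which solves a
    quadratic equation.  Hence [p = q] or [p = P], and both are absurd. *)
Require Import Defs.
From HB Require Import structures.
From mathcomp Require Import all_boot all_order all_algebra.
From mathcomp Require Import classical_sets reals.
From mathcomp Require Import ring lra.

Set Implicit Arguments.
Unset Strict Implicit.
Unset Printing Implicit Defensive.
Import Order.TTheory GRing.Theory Num.Theory.
Local Open Scope classical_set_scope.
Local Open Scope ring_scope.

(** * Planar geometry of the horizontal projections *)

Section Plane.
Variables (R : realFieldType) (d : R).

Lemma le_of_sqr (a b : R) : 0 <= b -> a ^+ 2 <= b ^+ 2 -> a <= b.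
Proof. by move=> b0 ab; rewrite leNgt; apply/negP => ba; nra. Qed.

(* An ellipse with foci [(0, 0)] and [(0, d)], parametrized by the height [z] of
   the point above it at distance 1 from [alpha4] and [alpha5]. *)
Definition on_ellipse (x y z : R) :=
  x ^+ 2 + y ^+ 2 = (1 - z) ^+ 2 /\ x ^+ 2 + (y - d) ^+ 2 = (d + z) ^+ 2.

Lemma on_ellipse_linear (x y z : R) :
  on_ellipse x y z -> 2 * d * y = 1 - 2 * (1 + d) * z.
Proof. by case=> h1 h2; lra. Qed.

(** The extremes are the vertices on the major axis: through the linear relation, [y - d <= d + z]
    gives the lower bound and [- y <= 1 - z] the upper one. *)
Lemma on_ellipse_bounds (x y z : R) : 0 < d -> 0 <= z <= 1 - d ->
  on_ellipse x y z -> 1 / 2 - d <= z <= 1 / 2.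
Proof.
move=> d_gt0 /andP[z0 zd] h; have hl := on_ellipse_linear h; case: h => h1 h2.
have x2 : 0 <= x ^+ 2 := sqr_ge0 x.
have yd : y - d <= d + z by apply: le_of_sqr; lra.
have yz : - y <= 1 - z by apply: le_of_sqr; lra.
by apply/andP; split; nra.
Qed.

Lemma on_ellipse_inj (x1 y1 x2 y2 z : R) :
  0 < d -> z = 1 / 2 \/ z = 1 / 2 - d ->
  on_ellipse x1 y1 z -> on_ellipse x2 y2 z -> x1 = x2 /\ y1 = y2.
Proof.
move=> d_gt0; have vertex x y : z = 1 / 2 \/ z = 1 / 2 - d -> on_ellipse x y z ->
  x = 0 /\ 2 * d * y = 1 - 2 * (1 + d) * z.
  move=> hz h; have hl := on_ellipse_linear h; split=> //; case: h => h1 h2.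
  apply/eqP; rewrite -sqrf_eq0; apply/eqP.
  case: hz => hz; subst z.
    have -> : x ^+ 2 = (1 - 1 / 2) ^+ 2 - y ^+ 2 by lra.
    have -> : y = - (1 / 2) by apply: (mulfI (lt0r_neq0 d_gt0)); lra.
    by field.
  have -> : x ^+ 2 = (1 - (1 / 2 - d)) ^+ 2 - y ^+ 2 by lra.
  have -> : y = d + 1 / 2 by apply: (mulfI (lt0r_neq0 d_gt0)); lra.
  by field.
move=> hz /(vertex _ _ hz)[-> h1] /(vertex _ _ hz)[-> h2]; split=> //.
by apply: (mulfI (lt0r_neq0 d_gt0)); lra.
Qed.

(** Parallel vectors are as far apart as the difference or the sum of their lengths. The difference
    would give [z1 - z2 = 1 / 2], but the bounds allow at most [d]; the sum would put both points at
    the vertex of height [1 / 2]. *)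
Lemma on_ellipse_independent (x1 y1 z1 x2 y2 z2 : R) : 0 < d -> d < 1 / 4 ->
  on_ellipse x1 y1 z1 -> on_ellipse x2 y2 z2 ->
  0 <= z1 <= 1 - d -> 0 <= z2 <= 1 - d -> z2 <= z1 ->
  (x1 - x2) ^+ 2 + (y1 - y2) ^+ 2 = (1 - (z1 - z2)) ^+ 2 ->
  x1 * y2 - x2 * y1 != 0.
Proof.
move=> d_gt0 d_lt e1 e2 b1 b2 z21 dist; apply/eqP => D0.
have /andP[l1 u1] := on_ellipse_bounds d_gt0 b1 e1.
have /andP[l2 u2] := on_ellipse_bounds d_gt0 b2 e2.
(* Lagrange's identity with vanishing determinant: equality in Cauchy-Schwarz. *)
have : (x1 * x2 + y1 * y2) ^+ 2 = ((1 - z1) * (1 - z2)) ^+ 2.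
  rewrite exprMn -e1.1 -e2.1.
  transitivity ((x1 ^+ 2 + y1 ^+ 2) * (x2 ^+ 2 + y2 ^+ 2)
    - (x1 * y2 - x2 * y1) ^+ 2); first by ring.
  by rewrite D0; ring.
move/eqP; rewrite eqf_sqr => /orP[] /eqP dot.
  suff : (z1 - z2) ^+ 2 = (1 - (z1 - z2)) ^+ 2 by move=> h; lra.
  by rewrite -dist; have := e1.1; have := e2.1; lra.
have : ((1 - z1) + (1 - z2)) ^+ 2 = (1 - (z1 - z2)) ^+ 2.
  by rewrite -dist; have := e1.1; have := e2.1; lra.
move/eqP; rewrite eqf_sqr => /orP[] /eqP h; last by lra.
have z2E : z2 = 1 / 2 by lra.
have z1E : z1 = 1 / 2 by lra.
subst z1 z2.
have [ex ey] := on_ellipse_inj d_gt0 (or_introl erefl) e1 e2.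
by move: dist; rewrite ex ey !subrr; lra.
Qed.

(** By Cramer's rule, both solutions are multiples, by [e] and by [g], of one fixed vector. *)
Lemma independent_collinear (x1 y1 z1 x2 y2 z2 ex ey e gx gy g : R) :
  x1 * y2 - x2 * y1 != 0 ->
  x1 * ex + y1 * ey = e * z1 -> x2 * ex + y2 * ey = e * z2 ->
  x1 * gx + y1 * gy = g * z1 -> x2 * gx + y2 * gy = g * z2 ->
  g * ex = e * gx /\ g * ey = e * gy.
Proof.
move=> D e1 e2 g1 g2; split; apply: (mulfI D).
  transitivity (g * (y2 * (x1 * ex + y1 * ey) - y1 * (x2 * ex + y2 * ey))).
    by ring.
  transitivity (e * (y2 * (x1 * gx + y1 * gy) - y1 * (x2 * gx + y2 * gy))).
    by rewrite e1 e2 g1 g2; ring.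
  by ring.
transitivity (g * (x1 * (x2 * ex + y2 * ey) - x2 * (x1 * ex + y1 * ey))).
  by ring.
transitivity (e * (x1 * (x2 * gx + y2 * gy) - x2 * (x1 * gx + y1 * gy))).
  by rewrite e1 e2 g1 g2; ring.
by ring.
Qed.

(** Here [rho] and [rho'] are the lengths of [p] and [p - q], and [z] is the height of the center;
    the equation for [2 * z] equates its distances from [alpha5] and [alpha4]. *)
Lemma planar_core (x1 y1 z1 x2 y2 z2 x3 y3 z3 px py rho rho' z : R) :
  0 < d -> d < 1 / 4 ->
  on_ellipse x1 y1 z1 -> on_ellipse x2 y2 z2 -> on_ellipse x3 y3 z3 ->
  0 <= z2 -> z2 <= z1 -> z1 <= z3 -> z3 <= 1 - d ->
  (x1 - x2) ^+ 2 + (y1 - y2) ^+ 2 = (1 - (z1 - z2)) ^+ 2 ->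
  (x3 - x1) ^+ 2 + (y3 - y1) ^+ 2 = (1 - (z3 - z1)) ^+ 2 ->
  (x3 - x2) ^+ 2 + (y3 - y2) ^+ 2 = (1 - (z3 - z2)) ^+ 2 ->
  0 <= rho -> 0 <= rho' ->
  px ^+ 2 + py ^+ 2 = rho ^+ 2 -> px ^+ 2 + (py - d) ^+ 2 = rho' ^+ 2 ->
  2 * z = 1 - d - rho + rho' ->
  (px - x1) ^+ 2 + (py - y1) ^+ 2 = (rho + z1) ^+ 2 ->
  (px - x2) ^+ 2 + (py - y2) ^+ 2 = (rho + z2) ^+ 2 ->
  (px - x3) ^+ 2 + (py - y3) ^+ 2 = (rho + z - `|z - z3|) ^+ 2 ->
  z1 <= z -> False.
Proof.
move=> d_gt0 d_lt e1 e2 e3 z2_ge0 z21 z13 z3d d12 d31 d32 rho0 rho'0 hp hp' hz c1 c2 c3 z1z.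
have b1 : 0 <= z1 <= 1 - d by apply/andP; split; lra.
have b2 : 0 <= z2 <= 1 - d by apply/andP; split; lra.
have b3 : 0 <= z3 <= 1 - d by apply/andP; split; lra.
have D := on_ellipse_independent d_gt0 d_lt e1 e2 b1 b2 z21 d12.
have /andP[l1 u1] := on_ellipse_bounds d_gt0 b1 e1.
have /andP[l2 u2] := on_ellipse_bounds d_gt0 b2 e2.
have /andP[l3 u3] := on_ellipse_bounds d_gt0 b3 e3.
(* Otherwise [Q1] and [Q2] are the same vertex, at height [1 / 2 - d]. *)
have not_top : z1 <= 1 / 2 - d -> False.
  move=> z1_le; have z1E : z1 = 1 / 2 - d by lra.
  have z2E : z2 = 1 / 2 - d by lra.
  subst z1 z2; have [ex ey] := on_ellipse_inj d_gt0 (or_intror erefl) e1 e2.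
  by move: d12; rewrite ex ey !subrr; lra.
have [e11 e12] := e1; have [e21 e22] := e2; have [e31 e32] := e3.
(* These are [|p| - |q|] and [|P| - |q|]. Subtracting the linear equations for [u = q] from those
   for [u = p] and [u = P] leaves homogeneous systems for [p - q] and [P - q]. *)
pose e := rho - d; pose g := 1 - z3 - d.
have g_neq0 : g != 0 by rewrite /g; lra.
have [ex ey] : g * px = e * x3 /\ g * (py - d) = e * (y3 - d).
  by apply: (independent_collinear (z1 := - z1) (z2 := - z2) D);
    rewrite /e /g; lra.
(* Case [p = q]: the center then has height [1 / 2 - d], too low for [z1 <= z]. *)
have [e0 | e_neq0] := eqVneq e 0.
  move: ex ey; rewrite e0 !mul0r => /eqP; rewrite mulf_eq0 (negPf g_neq0) /=.
  move=> /eqP px0 /eqP; rewrite mulf_eq0 (negPf g_neq0) /= => /eqP pyd.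
  have : rho' ^+ 2 = 0 by rewrite -hp' px0 pyd; ring.
  move/eqP; rewrite sqrf_eq0 => /eqP rho'E.
  by apply: not_top; rewrite /e in e0; lra.
(* Write [p - q = e w] and [P - q = g w]. For [s = e] and [s = g], [|q + s w| = d + s] reduces to
   [s (|w|^2 - 1) = 2 d (1 - w_y)]. Subtract the two and multiply by [g^2]. *)
have : (e - g) * ((d + z3) ^+ 2 - g ^+ 2) = 0.
  have E : px ^+ 2 + (py - d) ^+ 2 = e ^+ 2 + 2 * d * e - 2 * d * (py - d).
    by rewrite /e; lra.
  have G : (d + z3) ^+ 2 = g ^+ 2 + 2 * d * g - 2 * d * (y3 - d).
    by rewrite -e32 /g; lra.
  have E' : e ^+ 2 * (d + z3) ^+ 2 =
      g ^+ 2 * (e ^+ 2 + 2 * d * e) - 2 * d * g * (e * (y3 - d)).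
    rewrite -e32 -ey; transitivity ((g * px) ^+ 2 + (g * (py - d)) ^+ 2).
      by rewrite ex ey; ring.
    transitivity (g ^+ 2 * (px ^+ 2 + (py - d) ^+ 2)); first by ring.
    by rewrite E; ring.
  apply: (mulfI e_neq0); rewrite mulr0.
  transitivity (e ^+ 2 * (d + z3) ^+ 2 - e ^+ 2 * g ^+ 2
    - e * g * (d + z3) ^+ 2 + e * g * g ^+ 2); first by ring.
  by rewrite E' G; ring.
move/eqP; rewrite mulf_eq0 => /orP[/eqP eg|]; last first.
  rewrite subr_eq0 eqf_sqr => /orP[] /eqP h; last by rewrite /g in h; lra.
  by apply: not_top; rewrite /g in h; lra.
(* Now [p = P], and the heights agree as well: the center is the third point itself, although its
   distance from it should be [rho + z = 1]. *)
have {}eg : e = g by lra.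
have pxE : px = x3 by apply: (mulfI g_neq0); rewrite ex eg.
have pyE : py = y3.
  by apply: (addIr (- d)); apply: (mulfI g_neq0); rewrite ey eg.
have : rho' ^+ 2 = (d + z3) ^+ 2 by rewrite -hp' -e32 pxE pyE.
move/eqP; rewrite eqf_sqr => /orP[] /eqP h; last by lra.
have rhoE : rho = 1 - z3 by rewrite /e /g in eg; lra.
have zE : z = z3 by lra.
by move: c3; rewrite pxE pyE zE rhoE !subrr normr0; lra.
Qed.
End Plane.

(** * Reduction from space to the plane *)

Section Space.
Variable R : realType.
Implicit Types (u v t P Q c : 'rV[R]_3) (r d : R).

Lemma coordB u v :
  (xcoord (u - v) = xcoord u - xcoord v) *
  (ycoord (u - v) = ycoord u - ycoord v) *
  (zcoord (u - v) = zcoord u - zcoord v).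
Proof. by rewrite /xcoord /ycoord /zcoord !mxE. Qed.

Lemma normXC u v : normX (u - v) = normX (v - u).
Proof.
by rewrite /normX !coordB -opprB sqrrN -(opprB (ycoord v)) sqrrN distrC.
Qed.

Lemma normX_planar u r : normX u = r ->
  `|zcoord u| <= r /\
  xcoord u ^+ 2 + ycoord u ^+ 2 = (r - `|zcoord u|) ^+ 2.
Proof.
move=> <-; rewrite /normX addrK lerDr sqrtr_ge0 sqr_sqrtr //.
by rewrite addr_ge0 // sqr_ge0.
Qed.

Lemma normX_on_ellipse d Q : 0 <= zcoord Q <= 1 - d -> normX Q = 1 ->
  normX (point3 0 d (1 - d) - Q) = 1 ->
  on_ellipse d (xcoord Q) (ycoord Q) (zcoord Q).
Proof.
move=> /andP[z0 zd] /normX_planar[_ +] /normX_planar[_]; rewrite !coordB !point3E.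
by rewrite !ger0_norm ?subr_ge0 // => h2 h1; split; lra.
Qed.

(** The ordering of the heights fixes the sign in every absolute value except that of
    [zcoord c - zcoord P], which stays in the planar statement. *)
Lemma no_center_core d Q1 Q2 P c r : 0 < d -> d < 1 / 4 ->
  let t := point3 0 d (1 - d) in
  0 <= zcoord Q2 -> zcoord Q2 <= zcoord Q1 ->
  zcoord Q1 <= zcoord P -> zcoord P <= 1 - d ->
  normX Q1 = 1 -> normX Q2 = 1 -> normX P = 1 ->
  normX (t - Q1) = 1 -> normX (t - Q2) = 1 -> normX (t - P) = 1 ->
  normX (Q1 - Q2) = 1 -> normX (P - Q1) = 1 -> normX (P - Q2) = 1 ->
  normX c = r -> normX (t - c) = r ->
  normX (c - Q1) = r -> normX (c - Q2) = r -> normX (c - P) = r ->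
  zcoord Q1 <= zcoord c -> False.
Proof.
move=> d_gt0 d_lt t z2_ge0 z21 z13 z3d n1 n2 n3 t1 t2 t3.
move=> /normX_planar[_ d12] /normX_planar[_ d31] /normX_planar[_ d32].
move=> /normX_planar[cr hp] /normX_planar[cr' hp'].
move=> /normX_planar[_ c1] /normX_planar[_ c2] /normX_planar[_ c3] zc.
have e1 : on_ellipse d (xcoord Q1) (ycoord Q1) (zcoord Q1).
  by apply: normX_on_ellipse => //; apply/andP; split; lra.
have e2 : on_ellipse d (xcoord Q2) (ycoord Q2) (zcoord Q2).
  by apply: normX_on_ellipse => //; apply/andP; split; lra.
have e3 : on_ellipse d (xcoord P) (ycoord P) (zcoord P).
  by apply: normX_on_ellipse => //; apply/andP; split; lra.
have zc0 : 0 <= zcoord c by lra.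
rewrite !coordB /t !point3E in d12 d31 d32 cr' hp' c1 c2 c3.
rewrite (ger0_norm zc0) in cr hp.
(* Otherwise [|p - q| = |p| + 1 - d], exceeding the bound [|p| + d] of the triangle inequality. *)
have zcd : zcoord c < 1 - d.
  rewrite ltNge; apply/negP => zcd.
  rewrite ler0_norm in hp'; last by lra.
  have yr : - ycoord c <= r - zcoord c.
    by apply: le_of_sqr; have := sqr_ge0 (xcoord c); lra.
  by nra.
rewrite ger0_norm in d12; last by lra.
rewrite ger0_norm in d31; last by lra.
rewrite ger0_norm in d32; last by lra.
rewrite [`|_|]ger0_norm in cr'; last by lra.
rewrite ger0_norm in hp'; last by lra.
rewrite ger0_norm in c1; last by lra.
rewrite ger0_norm in c2; last by lra.
by apply: (planar_core (rho := r - zcoord c) (rho' := r - (1 - d - zcoord c))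
  (px := xcoord c) (py := ycoord c) (z := zcoord c) d_gt0 d_lt e1 e2 e3); lra.
Qed.
End Space.

Theorem theorem2 (R : realType)
  (alpha1 alpha2 alpha3 alpha4 alpha5 : 'rV[R]_3) (A : set 'rV[R]_3) (d : R)
  (A_def : A = [set alpha1; alpha2; alpha3; alpha4; alpha5])
  (A_five : uniq [:: alpha1; alpha2; alpha3; alpha4; alpha5])
  (A_equi : equilateral1 A)
  (alpha5_def : alpha5 = point3 0 0 0)
  (alpha4_def : alpha4 = point3 0 d (1 - d))
  (d_gt0 : 0 < d) (d_lt : d < 1 / 4)
  (z53 : zcoord alpha5 <= zcoord alpha3)
  (z32 : zcoord alpha3 <= zcoord alpha2)
  (z21 : zcoord alpha2 <= zcoord alpha1)
  (z14 : zcoord alpha1 <= zcoord alpha4) :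
  ~ has_center A.
Proof.
case=> c [r [_ center]].
have [m1 m2 m3 m4 m5] :
    [/\ A alpha1, A alpha2, A alpha3, A alpha4 & A alpha5].
  by rewrite A_def; split; rewrite /setU /=; tauto.
have a5 : alpha5 = 0.
  by apply/rowP => j; rewrite alpha5_def !mxE; case: j => [[|[|[]]]].
have norm_a5 a : A a -> a != alpha5 -> normX a = 1.
  by move=> ma /eqP ne; have := A_equi _ _ ma m5 ne; rewrite a5 subr0.
have dist a b : A a -> A b -> a != b -> normX (a - b) = 1.
  by move=> ma mb /eqP; apply: A_equi.
move: A_five; rewrite /= !inE !negb_or => /and5P[/and4P[n12 n13 n14 n15]].
move=> /and3P[n23 n24 n25] /andP[n34 n35] n45 _.
have dist4 a : A a -> a != alpha4 -> normX (alpha4 - a) = 1.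
  by rewrite normXC; auto.
have c5 : normX c = r by rewrite -(center _ m5) a5 subr0.
have c4 : normX (alpha4 - c) = r by rewrite normXC; auto.
rewrite alpha5_def !point3E in z53.
have z4 : zcoord alpha4 = 1 - d by rewrite alpha4_def !point3E.
have core := @no_center_core _ d _ _ _ _ _ d_gt0 d_lt.
rewrite -alpha4_def -z4 /= in core.
(* Comparing with the middle height finds two of the three points on one side of the center. *)
have [zc | zc] := leP (zcoord alpha2) (zcoord c).
  by apply: (core alpha2 alpha3 alpha1 c r); auto.
(* The isometry [u |-> alpha4 - u] exchanges [alpha4] and [alpha5] and reverses
   the heights. *)
have flipB u v : (alpha4 - u) - (alpha4 - v) = v - u.
  by rewrite opprB addrC subrKA.
have flipK u : alpha4 - (alpha4 - u) = u by rewrite opprB addrC subrK.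
apply: (core (alpha4 - alpha2) (alpha4 - alpha1) (alpha4 - alpha3)
         (alpha4 - c) r);
  rewrite ?flipK ?flipB ?coordB; auto; try lra; by rewrite normXC; auto.
Qed.
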